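(* Fix $\beta$ with $1<\beta\le 2$. Let $(x_n)_{n\ge1}$ be a real sequence such that $x_{n+1}-x_n\ge c$ for all $n$, for some constant $c>0$. Suppose that for every $\varepsilon>0$ there is a constant $C(\varepsilon)$ such that for all $N$, $$\sum_{1\le j_1,j_2< N^{\beta-\varepsilon}}\ \sum_{\substack{1\le m_1,m_2,n_1,n_2\le N\\ m_1\ne n_1,\ m_2\ne n_2}} \mathbb{1}\Big(\big|j_1(x_{m_1}-x_{n_1})-j_2(x_{m_2}-x_{n_2})\big|<1\Big)\le C(\varepsilon)N^{4-\varepsilon}.$$ Then for almost every $\alpha\in\mathbb{R}$, for every $\varepsilon>0$, $$\delta_{\min}^{\alpha}(N)\ll \frac{1}{N^{\beta-\varepsilon}},$$ where the implied constant may depend on $\alpha$ and $\varepsilon$.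
   Context: For $x\in\mathbb{R}$, $\|x\|=\min_{k\in\mathbb{Z}}|x-k|$. For $\alpha\in\mathbb{R}$ and $N\ge2$, $\delta_{\min}^{\alpha}(N)=\min\{\|\alpha x_m-\alpha x_n\| : 1\le m,n\le N,\ m\ne n\}$. $\mathbb{1}(\cdot)$ denotes the indicator of the stated condition. *)

(* Defs.v *)
From HB Require Import structures.
From mathcomp Require Import all_boot all_order all_algebra.
From mathcomp Require Import all_classical all_reals all_analysis.
Set Implicit Arguments. Unset Strict Implicit. Unset Printing Implicit Defensive.
Import Order.TTheory GRing.Theory Num.Theory.
Local Open Scope classical_set_scope.
Local Open Scope ring_scope.

(* ||x|| = min_{k in Z} |x - k| (the min is attained, so it is the inf) *)
Definition dist_int {R : realType} (x : R) : R :=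
  inf [set `|x - k%:~R| | k in [set: int]].

Definition delta_min {R : realType} (alpha : R) (x : nat -> R) (N : nat) : R :=
  inf [set d | exists m n : nat, [/\ (1 <= m <= N)%N, (1 <= n <= N)%N, m <> n &
         d = dist_int (alpha * x m - alpha * x n)]].

(* The quadruple-sum energy in the hypothesis, with indicator as 0/1 in R.
   j ranges over 1 <= j, j < N^(beta-eps); the outer cutoff N^2+1 is harmless
   since N^(beta-eps) <= N^2 when beta - eps < 2. *)
Definition energy {R : realType} (x : nat -> R) (e : R) (N : nat) : R :=
  \sum_(1 <= j1 < (N ^ 2)%N.+1 | (j1%:R < N%:R `^ e))
  \sum_(1 <= j2 < (N ^ 2)%N.+1 | (j2%:R < N%:R `^ e))
  \sum_(1 <= m1 < N.+1) \sum_(1 <= n1 < N.+1 | m1 != n1)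
  \sum_(1 <= m2 < N.+1) \sum_(1 <= n2 < N.+1 | m2 != n2)
    ((`|j1%:R * (x m1 - x n1) - j2%:R * (x m2 - x n2)| < 1 :> R) : bool)%:R.

(* Main.v *)
(* Let N be given and let K be the largest integer below N^(beta - eps).
   Put w = pi / (K + 1) and P(t) = sum_(1 <= k <= K) sin(k w) e^(i k t). The
   cosine polynomial (cos t - cos 2w) |P(t)|^2, of degree at most K, is
   nonpositive when the distance of t / 2pi to the integers is at least
   1 / (K + 1), has a positive mean, and has coefficients bounded by 6 times
   that mean. Summed over t = 2 pi alpha (x_m - x_n), m <> n, it shows that
   delta_min^alpha(N) >= 1 / (K + 1) forces the oscillating part
   S(alpha) = sum_(j, m, n) b_j cos(2 pi j (x_m - x_n) alpha) to be at least
   N^2 / 2 in absolute value. The integral of S^2 against the weight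
   1 + cos(pi alpha / A) on [-A, A] is bounded by a constant times the number of
   pairs of frequencies at distance less than 1, that is, by the energy: the
   Fourier transform of the weight decays quadratically, and the Schur test
   reduces all pairs of unit intervals to the diagonal ones. Chebyshev's
   inequality makes the exceptional set of measure O(N^(-eps)), which is summable
   along N = 2^k, and Borel-Cantelli and the monotonicity of delta_min in N
   conclude. *)
Require Import Defs.
From HB Require Import structures.
From mathcomp Require Import all_boot all_order all_algebra.
From mathcomp Require Import all_classical all_reals all_analysis.
From mathcomp Require Import measurable_realfun ring lra zify.
Import Order.TTheory GRing.Theory Num.Theory.
Import numFieldNormedType.Exports.
Local Open Scope classical_set_scope.
Local Open Scope ring_scope.

(** * A trigonometric polynomial positive only near the integers *)

(** With truncated subtraction, [p - q + (q - p)] is the distance between [p] and [q]. Each distance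
    occurs at most once on either side of [p], hence the factor 2. *)
Lemma sum_dist_le (R : realDomainType) (f : nat -> R) (M p : nat) :
  (forall k, 0 <= f k) -> (p < M)%N ->
  \sum_(q < M) f (p - q + (q - p))%N <= 2 * \sum_(k < M) f k.
Proof.
move=> f0 pM; rewrite mulrDl mul1r -!(big_mkord predT f).
have sub m : (m <= M)%N -> \sum_(0 <= k < m) f k <= \sum_(0 <= k < M) f k.
  move=> mM; rewrite (big_cat_nat (n := m) (p := M)) //= lerDl.
  by apply: sumr_ge0.
rewrite -(big_mkord predT (fun q => f (p - q + (q - p))%N)).
rewrite (big_cat_nat (n := p.+1)) //=; apply: lerD.
  rewrite big_nat_rev /=; apply: le_trans (sub _ pM).
  by apply: ler_sum_nat => i /andP[_ ip]; rewrite le_eqVlt; apply/orP; left;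
    apply/eqP; congr f; lia.
rewrite -[X in \sum_(X <= _ < _) _]add0n big_addn.
apply: le_trans (sub (M - p.+1).+1 _); last lia.
rewrite big_nat_recl //= ler_wpDl //.
by apply: ler_sum_nat => i _; rewrite le_eqVlt; apply/orP; left; apply/eqP;
  congr f; lia.
Qed.

Lemma sum_eq_indic (R : pzSemiRingType) (f : nat -> R) (M j : nat) :
  (j < M)%N -> \sum_(k < M) (j == k)%:R * f k = f j.
Proof.
move=> jM; rewrite (bigD1 (Ordinal jM)) //= eqxx mul1r big1 ?addr0 // => k kj.
suff /negPf -> : j != k by rewrite mul0r.
by apply: contra kj => /eqP jk; apply/eqP/val_inj.
Qed.

(** The product [s k * s l] is at most half of [s k ^+ 2 + s l ^+ 2] in absolute value; the symmetry
    of [g] then reduces the double sum to row sums. *)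
Lemma schur_test (R : realFieldType) (I : finType) (g : I -> I -> R) (s : I -> R)
    (C : R) :
  (forall k l, 0 <= g k l) -> (forall k l, g k l = g l k) ->
  (forall k, \sum_l g k l <= C) ->
  `|\sum_k \sum_l g k l * (s k * s l)| <= C * \sum_k s k ^+ 2.
Proof.
move=> g0 gC gle; apply: le_trans (ler_norm_sum _ _ _) _.
apply: (@le_trans _ _ (\sum_k \sum_l
   (2^-1 * (g k l * s k ^+ 2) + 2^-1 * (g l k * s l ^+ 2)))).
  apply: ler_sum => k _; apply: le_trans (ler_norm_sum _ _ _) _.
  apply: ler_sum => l _; rewrite (gC l k) -mulrDr -mulrDr normrM (ger0_norm (g0 _ _)).
  rewrite mulrCA; apply: ler_wpM2l => //.
  have := sqr_ge0 (s k - s l); have := sqr_ge0 (s k + s l).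
  by rewrite ler_norml => ? ?; apply/andP; split; nra.
under eq_bigr do rewrite big_split.
rewrite big_split /= [X in _ + X]exchange_big /=.
have half : \sum_k \sum_l 2^-1 * (g k l * s k ^+ 2) <= 2^-1 * (C * \sum_k s k ^+ 2).
  rewrite !mulr_sumr; apply: ler_sum => k _.
  by rewrite -mulr_sumr -mulr_suml ler_pM2l // ler_wpM2r ?sqr_ge0.
rewrite (_ : C * _ = 2^-1 * (C * \sum_k s k ^+ 2) + 2^-1 * (C * \sum_k s k ^+ 2)).
  exact: lerD.
by field.
Qed.

(** The discrete Wronskian [s k * u k.+1 - s k.+1 * u k] grows by [2 * (b - a) * (s k.+1 * u k.+1)]
    when [k] becomes [k.+1], so the sum telescopes. *)
Lemma sum_wronskian (R : comRingType) (s u : nat -> R) (a b : R) (K : nat) :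
  (forall k, s k.+2 = 2 * a * s k.+1 - s k) ->
  (forall k, u k.+2 = 2 * b * u k.+1 - u k) ->
  2 * (b - a) * \sum_(1 <= k < K.+1) s k * u k =
  (s K * u K.+1 - s K.+1 * u K) - (s 0%N * u 1%N - s 1%N * u 0%N).
Proof.
move=> hs hu; elim: K => [|K IH]; first by rewrite big_geq//; ring.
by rewrite big_nat_recr//= mulrDr IH hs hu; ring.
Qed.

Lemma cos_rec (R : realType) (t : R) (k : nat) :
  cos (k.+2%:R * t) = 2 * cos t * cos (k.+1%:R * t) - cos (k%:R * t).
Proof.
have -> : k.+2%:R * t = k.+1%:R * t + t by rewrite -natr1; ring.
have -> : k%:R * t = k.+1%:R * t - t by rewrite -natr1; ring.
by rewrite cosD cosB; ring.
Qed.

Lemma sin_rec (R : realType) (t : R) (k : nat) :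
  sin (k.+2%:R * t) = 2 * cos t * sin (k.+1%:R * t) - sin (k%:R * t).
Proof.
have -> : k.+2%:R * t = k.+1%:R * t + t by rewrite -natr1; ring.
have -> : k%:R * t = k.+1%:R * t - t by rewrite -natr1; ring.
by rewrite sinD sinB; ring.
Qed.

(** This is the squared modulus of an exponential sum in real form: it involves only differences of
    phases and is visibly nonnegative. *)
Lemma cos_sum_sqr (R : realType) (I : finType) (b v : I -> R) :
  \sum_i \sum_j b i * b j * cos (v i - v j) =
  (\sum_i b i * cos (v i)) ^+ 2 + (\sum_i b i * sin (v i)) ^+ 2.
Proof.
rewrite !expr2 !big_distrlr /= -big_split; apply: eq_bigr => i _.
by rewrite -big_split; apply: eq_bigr => j _; rewrite /= cosB; ring.
Qed.

(* The two telescoping sums give [2 (cos t - cos w) Re P] and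
   [2 (cos t - cos w) Im P]; the symmetry [s (K + 1 - k) = s k] then collapses
   [(cos t - cos w) |P|^2] to a single sum. *)
Lemma fejer_identity (R : realType) (K : nat) (t : R) (w := pi / K.+1%:R : R) :
  (cos t - cos w) * \sum_(k < K.+1) \sum_(l < K.+1)
     sin (k%:R * w) * sin (l%:R * w) * cos (k%:R * t - l%:R * t) =
  sin w * \sum_(k < K.+1) sin (k%:R * w) * cos (k%:R * t).
Proof.
pose s k := sin (k%:R * w).
have s0 : s 0%N = 0 by rewrite /s mul0r sin0.
have s1 : s 1%N = sin w by rewrite /s mul1r.
have Kw : K.+1%:R * w = pi by rewrite /w mulrC divfK.
have sK1 : s K.+1 = 0 by rewrite /s Kw sinpi.
have srev k : (k <= K.+1)%N -> s (K.+1 - k)%N = s k.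
  by move=> kK; rewrite /s natrB // mulrBl Kw sinB sinpi cospi; ring.
have sK : s K = sin w by rewrite -s1 -(srev 1%N) // subn1.
have toN (f : nat -> R) : \sum_(k < K.+1) s k * f k =
    \sum_(1 <= k < K.+1) s k * f k.
  by rewrite -(big_mkord predT (fun k => s k * f k)) big_ltn // s0 mul0r add0r.
rewrite (cos_sum_sqr _ _ (fun k : 'I_K.+1 => s k) (fun k : 'I_K.+1 => k%:R * t)).
set C := \sum_k _ * cos _; set D := \sum_k _ * sin _.
have hC : 2 * (cos t - cos w) * C = sin w * (1 + cos (K.+1%:R * t)).
  rewrite /C (toN (fun k => cos (k%:R * t))).
  rewrite (sum_wronskian _ s (fun k => cos (k%:R * t))) /s; last first.
  - by move=> k; exact: cos_rec.
  - by move=> k; exact: sin_rec.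
  by rewrite -!/(s _) s0 s1 sK sK1 !mul0r cos0; ring.
have hD : 2 * (cos t - cos w) * D = sin w * sin (K.+1%:R * t).
  rewrite /D (toN (fun k => sin (k%:R * t))).
  rewrite (sum_wronskian _ s (fun k => sin (k%:R * t))) /s; last first.
  - by move=> k; exact: sin_rec.
  - by move=> k; exact: sin_rec.
  by rewrite -!/(s _) s0 s1 sK sK1 !mul0r sin0; ring.
have hCD : C * cos (K.+1%:R * t) + D * sin (K.+1%:R * t) = C.
  rewrite /C /D (toN (fun k => cos (k%:R * t))) (toN (fun k => sin (k%:R * t))).
  rewrite !mulr_suml -big_split /= [RHS]big_nat_rev /=.
  apply: eq_big_nat => k /andP[k1 kK].
  rewrite add1n subSS srev; last lia.
  by rewrite natrB; [rewrite mulrBl cosB; ring|lia].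
rewrite -/C; apply: (@mulfI _ 2) => //.
transitivity (2 * (cos t - cos w) * C * C + 2 * (cos t - cos w) * D * D).
  by ring.
rewrite hC hD.
transitivity (sin w * (C + (C * cos (K.+1%:R * t) + D * sin (K.+1%:R * t)))).
  by ring.
by rewrite hCD; ring.
Qed.

(** By the double angle formula, it suffices that the cosines of the [K.+1] equally spaced angles
    [2 * k * w] on the circle sum to zero. *)
Lemma sum_sqr_sin (R : realType) (K : nat) (w := pi / K.+1%:R : R) : (0 < K)%N ->
  \sum_(k < K.+1) sin (k%:R * w) ^+ 2 = K.+1%:R / 2.
Proof.
move=> K0.
have w0 : 0 < w by rewrite divr_gt0 // pi_gt0.
have wpi : w < pi.
  by rewrite /w ltr_pdivrMr // ltr_pMr ?pi_gt0 // ltr1n ltnS.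
have Kw : K.+1%:R * w = pi by rewrite /w mulrC divfK.
have sw : sin w != 0 by rewrite gt_eqF // sin_gt0_pi // w0.
(* [2 * sin w * cos (2 * k * w)] is the difference of the sines of [(2 * k + 1) * w] and
   [(2 * k - 1) * w]. *)
have tel n : 2 * sin w * \sum_(0 <= k < n) cos (2 * k%:R * w) =
    sin ((2 * n%:R - 1) * w) + sin w.
  elim: n => [|n IH].
    by rewrite big_geq // mulr0 mulr0 sub0r mulN1r sinN addNr.
  rewrite big_nat_recr //= mulrDr IH -[n.+1%:R]natr1.
  have -> : (2 * (n%:R + 1) - 1) * w = 2 * n%:R * w + w by ring.
  have -> : (2 * n%:R - 1) * w = 2 * n%:R * w - w by ring.
  by rewrite (sinD _ w) sinB; ring.
have : \sum_(0 <= k < K.+1) cos (2 * k%:R * w) = 0.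
  apply: (@mulfI _ (2 * sin w)); first by rewrite mulf_neq0.
  rewrite tel mulr0.
  have -> : (2 * K.+1%:R - 1) * w = - w + pi *+ 2.
    by rewrite mulrBl mul1r -mulrA Kw mulr2n; ring.
  by rewrite sinD2pi sinN addNr.
rewrite big_mkord => h.
have : \sum_(k < K.+1) (1 - 2 * sin (k%:R * w) ^+ 2) = 0 :> R.
  rewrite -[RHS]h; apply: eq_bigr => k _.
  have -> : 2 * k%:R * w = (k%:R * w) *+ 2 by rewrite mulr2n; ring.
  by rewrite cos_mulr2n cos2sin2; ring.
rewrite sumrB sumr_const card_ord -mulr_sumr => /eqP; rewrite subr_eq0 => /eqP.
by move=> ->; field.
Qed.

(** The right side is four times the mean of the cosine polynomial. The bound combines
    [1 <= K.+1%:R * sin w] with [sin w ^+ 2 <= 2 * (cos w - cos (2 * w))]. *)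
Lemma sin_le_minorant_mean (R : realType) (K : nat) (w := pi / K.+1%:R : R) : (0 < K)%N ->
  0 <= sin w <= 4 * ((cos w - cos (2 * w)) * (K.+1%:R / 2)).
Proof.
move=> K0.
have w0 : 0 < w by rewrite divr_gt0 // pi_gt0.
have w2 : w <= pi / 2.
  by rewrite /w ler_wpM2l ?pi_ge0 // lef_pV2 ?posrE // ler_nat.
have pi0 := @pi_gt0 R.
have Kw : K.+1%:R * w = pi by rewrite /w mulrC divfK.
have sw : 0 < sin w by apply: sin_gt0_pi; rewrite w0 /=; lra.
have cw : 0 <= cos w by apply: cos_ge0_pihalf; apply/andP; split; lra.
have cw1 := cos_le1 w.
have chalf : 0 <= cos (w / 2) by apply: cos_ge0_pihalf; apply/andP; split; lra.
have shalf : 0 <= sin (w / 2) by apply: sin_ge0_pi; apply/andP; split; lra.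
have hw : w = (w / 2) *+ 2 by rewrite mulr2n; field.
have ch2 : 1 <= 2 * cos (w / 2).
  have : cos w = cos (w / 2) ^+ 2 *+ 2 - 1 by rewrite {1}hw cos_mulr2n.
  by rewrite mulr2n => e; nra.
(* For [n = K.+1] the angle is [pi / 2], which gives [1 <= K.+1%:R * sin (w / 2)]. *)
have sub n : `|sin (n%:R * (w / 2))| <= n%:R * sin (w / 2).
  elim: n => [|n IH]; first by rewrite !mul0r sin0 normr0.
  rewrite -[n.+1%:R]natr1 !mulrDl !mul1r sinD.
  apply: (le_trans (ler_normD _ _)); apply: lerD.
    by rewrite normrM; apply: le_trans IH; rewrite ler_piMr // cos_max.
  by rewrite normrM (ger0_norm shalf) ler_piMl // cos_max.
have Ks : 1 <= K.+1%:R * sin w.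
  have := sub K.+1; rewrite mulrA Kw sin_pihalf normr1 => h.
  have -> : sin w = 2 * (cos (w / 2) * sin (w / 2)).
    by rewrite {1}hw sin_mulr2n mulr2n; ring.
  rewrite (_ : _ * _ = (K.+1%:R * sin (w / 2)) * (2 * cos (w / 2))); last by ring.
  by rewrite -[leLHS]mulr1 ler_pM.
rewrite (ltW sw) /=.
have -> : cos (2 * w) = 2 * cos w ^+ 2 - 1.
  by rewrite (_ : 2 * w = w *+ 2); [rewrite cos_mulr2n mulr2n; ring|rewrite mulr2n; ring].
have e := cos2Dsin2 w.
have h1 : sin w ^+ 2 <= 2 * (cos w - (2 * cos w ^+ 2 - 1)) by nra.
have : sin w * 1 <= sin w * (K.+1%:R * sin w) by rewrite ler_pM2l.
have : K.+1%:R * sin w ^+ 2 <= K.+1%:R * (2 * (cos w - (2 * cos w ^+ 2 - 1))).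
  by rewrite ler_pM2l.
by lra.
Qed.

(** The polynomial is the squared modulus of a sine-weighted exponential sum times
    [cos t - cos (2 * w)], divided by its mean [A * a0]; its sign is that of the factor
    [cos t - cos (2 * w)]. *)
Lemma trig_minorant (R : realType) (K : nat) : (0 < K)%N ->
  exists b : nat -> R, (forall j, `|b j| <= 6) /\
    forall t : R, cos t <= cos (2 * (pi / K.+1%:R)) ->
      1 + \sum_(1 <= j < K.+1) b j * cos (j%:R * t) <= 0.
Proof.
move=> K0; set w : R := pi / K.+1%:R.
pose s k := sin (k%:R * w).
pose A := cos w - cos (2 * w).
pose a0 := \sum_(k < K.+1) s k ^+ 2.
have a0E : a0 = K.+1%:R / 2 by exact: sum_sqr_sin.
have a0gt : 0 < a0 by rewrite a0E divr_gt0.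
have /andP[sw hsw] : 0 <= sin w <= 4 * (A * a0).
  by rewrite a0E; exact: sin_le_minorant_mean.
have sw0 : 0 < sin w.
  apply: sin_gt0_pi; rewrite divr_gt0 ?pi_gt0 //=.
  by rewrite ltr_pdivrMr // ltr_pMr ?pi_gt0 // ltr1n ltnS.
have c0gt : 0 < A * a0 by lra.
have Agt : 0 < A by rewrite -(pmulr_lgt0 A a0gt).
pose d (k l : nat) := (k - l + (l - k))%N.
pose b' j := \sum_(k < K.+1) \sum_(l < K.+1) (d k l == j)%:R * (s k * s l).
(* In [cos t - cos (2 * w) = A + (cos t - cos w)], the summand [A] contributes [A * b' j], where
   [b' j] is the coefficient of the squared modulus, and [cos t - cos w] contributes [sin w * s j]
   by [fejer_identity]. *)
exists (fun j => (A * b' j + sin w * s j) / (A * a0)); split.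
  move=> j; rewrite normrM normfV (gtr0_norm c0gt) ler_pdivrMr //.
  apply: le_trans (ler_normD _ _) _; rewrite !normrM (gtr0_norm Agt).
  rewrite (ger0_norm sw).
  have h1 : sin w * `|s j| <= sin w by rewrite ler_piMr // sin_max.
  (* For each [k] at most two [l] lie at distance [j], so the Schur test applies with row sums at
     most 2. *)
  have h2 : `|b' j| <= 2 * a0.
    have dC k l : d k l = d l k by rewrite /d; lia.
    have cnt (k : 'I_K.+1) : \sum_(l < K.+1) (d k l == j)%:R <= 2 :> R.
      apply: le_trans (sum_dist_le _ (fun i => (i == j)%:R) _ _ _ (ltn_ord k)) _.
        by move=> i; rewrite ler0n.
      rewrite ler_piMr //; case: (ltnP j K.+1) => jK.
        under eq_bigr do rewrite eq_sym -[_%:R]mulr1.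
        by rewrite (sum_eq_indic _ (fun=> 1)).
      rewrite big1 // => i _; suff /negPf -> : val i != j by [].
      by rewrite neq_ltn (leq_trans (ltn_ord i) jK).
    apply: (schur_test _ _ (fun k l : 'I_K.+1 => (d k l == j)%:R) (fun k => s k)) => //.
    by move=> k l; rewrite dC.
  (* The two parts are at most [2 * A * a0] and [4 * A * a0], whence the constant 6. *)
  nra.
move=> t ht; pose Q := \sum_(k < K.+1) \sum_(l < K.+1)
  s k * s l * cos (k%:R * t - l%:R * t).
have Q0 : 0 <= Q.
  rewrite /Q (cos_sum_sqr _ _ (fun k : 'I_K.+1 => s k) (fun k : 'I_K.+1 => k%:R * t)).
  by rewrite addr_ge0 ?sqr_ge0.
have F := fejer_identity R K t; rewrite /= -/w -/Q in F.
have QE : Q = \sum_(j < K.+1) b' j * cos (j%:R * t).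
  under [RHS]eq_bigr do rewrite mulr_suml.
  rewrite exchange_big; apply: eq_bigr => k _ /=.
  under [RHS]eq_bigr do rewrite mulr_suml.
  rewrite exchange_big; apply: eq_bigr => l _ /=.
  transitivity (\sum_(j < K.+1) (d k l == j)%:R * (s k * s l * cos (j%:R * t))).
    rewrite (sum_eq_indic _ (fun j => s k * s l * cos (j%:R * t))).
      congr (_ * _); case: (leqP k l) => kl.
        rewrite -cosN opprB -mulrBl -natrB //; congr (cos (_%:R * _)).
        by rewrite /d; lia.
      rewrite -mulrBl -natrB ?(ltnW kl) //; congr (cos (_%:R * _)).
      by rewrite /d; lia.
    by have := ltn_ord k; have := ltn_ord l; rewrite /d; lia.
  by apply: eq_bigr => j _; rewrite !mulrA.
have b0 : b' 0%N = a0.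
  apply: eq_bigr => k _.
  rewrite [RHS]expr2 -[RHS](sum_eq_indic _ (fun l => s k * s l) _ _ (ltn_ord k)).
  by apply: eq_bigr => l _; congr (_%:R * _); congr nat_of_bool; rewrite /d; lia.
have s0 : s 0%N = 0 by rewrite /s mul0r sin0.
rewrite -(big_mkord predT (fun j => s j * cos (j%:R * t))) in F.
rewrite -(big_mkord predT (fun j => b' j * cos (j%:R * t))) in QE.
(* The constant terms are split off: 0 in the sine part because [s 0 = 0], and [a0] in the squared
   modulus. *)
rewrite big_ltn // s0 mul0r add0r in F.
rewrite big_ltn // b0 mul0r cos0 mulr1 in QE.
rewrite -(pmulr_rle0 _ c0gt).
have -> : A * a0 * (1 + \sum_(1 <= j < K.+1)
    (A * b' j + sin w * s j) / (A * a0) * cos (j%:R * t)) = (cos t - cos (2 * w)) * Q.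
  transitivity (A * Q + (cos t - cos w) * Q); last by rewrite /A; ring.
  rewrite F QE mulrDr mulrDr mulr1 -addrA; congr (_ + _).
  rewrite ![_ * \sum_(1 <= _ < _) _]mulr_sumr -big_split; apply: eq_bigr => j _ /=.
  by rewrite [_ / _ * _]mulrAC [LHS]mulrC divfK ?gt_eqF //; ring.
by rewrite mulr_le0_ge0 // subr_le0.
Qed.

(** * The second moment of a cosine sum *)

(** The case [l == 0] is separate because division by zero returns 0, while the primitive of the
    constant 1 is [a]; coinciding frequencies do occur. *)
Definition cos_primitive (R : realType) (l a : R) : R :=
  if l == 0 then a else sin (l * a) / l.

Lemma is_derive_cos_primitive (R : realType) (l a : R) :
  is_derive a 1 (cos_primitive R l) (cos (l * a)).
Proof.
rewrite /cos_primitive; case: eqVneq => [->|l0].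
  by rewrite mul0r cos0; exact: is_derive_id.
have h : is_derive a 1 (l \*: (@id R : R^o -> R^o)) (l *: (1 : R^o)).
  exact: is_deriveZ.
have hs := is_derive1_comp (is_derive_sin (l * a)) h.
have -> : (fun a => sin (l * a) / l) =
    l^-1 \*: ((sin : R^o -> R^o) \o (l \*: (@id R : R^o -> R^o))).
  by apply/funext => y /=; rewrite /GRing.scale /= mulrC.
have -> : cos (l * a) = l^-1 *: (cos (l * a) * (l *: (1 : R^o))).
  by rewrite /GRing.scale /= mulr1 mulrCA mulVf // mulr1.
exact: is_deriveZ.
Qed.

Lemma cos_primitiveN (R : realType) (l a : R) :
  cos_primitive R l (- a) = - cos_primitive R l a.
Proof. by rewrite /cos_primitive; case: eqP => // _; rewrite mulrN sinN mulNr. Qed.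

Lemma norm_sin_le (R : realType) (x : R) : `|sin x| <= `|x|.
Proof.
wlog x0 : x / 0 <= x.
  move=> h; case: (leP 0 x) => [/h//|x0].
  by rewrite -[leLHS]normrN -sinN -[leRHS]normrN h // oppr_ge0 ltW.
move: x0; rewrite le_eqVlt => /predU1P[<-|x0]; first by rewrite sin0 normr0.
have [c _] := MVT x0 (fun y _ => is_derive_sin y)
  (continuous_subspaceT (@continuous_sin R)).
rewrite sin0 !subr0 => ->.
by rewrite normrM ler_piMl // cos_max.
Qed.

(* Fourier transform at [t] of the weight [1 + cos (pi a / A)] on [-A, A]. *)
Definition hann_transform (R : realType) (A t : R) : R :=
  2 * cos_primitive R (2 * pi * t) A +
  cos_primitive R (2 * pi * t + pi / A) A +
  cos_primitive R (2 * pi * t - pi / A) A.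

Lemma hann_transform_le (R : realType) (A t : R) : 0 <= A ->
  `|hann_transform R A t| <= 4 * A.
Proof.
move=> A0.
have P l : `|cos_primitive R l A| <= A.
  rewrite /cos_primitive; case: eqP => [_|/eqP l0]; first by rewrite ger0_norm.
  rewrite normrM normfV ler_pdivrMr ?normr_gt0 //.
  by rewrite (le_trans (norm_sin_le _ _)) // normrM (ger0_norm A0) mulrC.
rewrite /hann_transform; apply: le_trans (ler_normD _ _) _.
rewrite (_ : 4 * A = 2 * A + A + A); last by ring.
apply: lerD => //; apply: le_trans (ler_normD _ _) _; apply: lerD => //.
by rewrite normrM ger0_norm // ler_pM2l.
Qed.

(** Since [p * A = pi], the three sines agree up to sign, and [2 / s - 1 / (s + p) - 1 / (s - p)]
    collapses to [- 2 * p ^+ 2 / (s * (s ^+ 2 - p ^+ 2))]. This reflects the double zero of the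
    weight at both ends of the interval. *)
Lemma hann_transform_decay (R : realType) (A t : R) : 1 <= A -> 1 <= `|t| ->
  `|hann_transform R A t| <= (t ^+ 2)^-1.
Proof.
move=> A1 t1.
have A0 : 0 < A by apply: lt_le_trans A1.
have pi2 := @pi_ge2 R; have pi0 := @pi_gt0 R.
set s := 2 * pi * t; set p := pi / A.
have p0 : 0 < p by rewrite divr_gt0.
have pA : p * A = pi by rewrite divfK // gt_eqF.
have ppi : p <= pi by rewrite ler_pdivrMr // ler_pMr.
have t2 : 1 <= t ^+ 2 by rewrite -real_normK ?num_real // expr_ge1.
have sp2 : 3 * pi ^+ 2 * t ^+ 2 <= s ^+ 2 - p ^+ 2.
  have : p ^+ 2 <= pi ^+ 2 by rewrite lerXn2r // nnegrE ltW.
  have : pi ^+ 2 * 1 <= pi ^+ 2 * t ^+ 2 by rewrite ler_pM2l // exprn_gt0.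
  by rewrite /s; lra.
have sp0 : 0 < s ^+ 2 - p ^+ 2.
  apply: lt_le_trans sp2; apply: mulr_gt0; last exact: lt_le_trans t2.
  by apply: mulr_gt0 => //; exact: exprn_gt0.
have t0 : t != 0 by rewrite -normr_gt0; apply: lt_le_trans t1.
have s0 : s != 0 by rewrite !mulf_neq0 // gt_eqF.
have : (s - p) * (s + p) != 0 by rewrite -subr_sqr gt_eqF.
rewrite mulf_eq0 negb_or => /andP[sm sp].
have hp : sin ((s + p) * A) = - sin (s * A).
  by rewrite mulrDl pA sinDpi.
have hm : sin ((s - p) * A) = - sin (s * A).
  by rewrite mulrBl pA sinB sinpi cospi; ring.
rewrite /hann_transform -/s -/p /cos_primitive (negPf s0) (negPf sp) (negPf sm) hp hm.
have -> : 2 * (sin (s * A) / s) + - sin (s * A) / (s + p) + - sin (s * A) / (s - p)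
   = sin (s * A) * (- (2 * p ^+ 2) / (s * (s ^+ 2 - p ^+ 2))).
  by rewrite subr_sqr; field; rewrite s0 sp sm.
rewrite normrM -[leRHS]mul1r; apply: ler_pM => //; first exact: sin_max.
rewrite normrM normfV normrN normrM [`|s * _|]normrM (gtr0_norm sp0).
rewrite [`|2|]ger0_norm // [`|p ^+ 2|]ger0_norm ?sqr_ge0 //.
have sabs : 4 <= `|s|.
  rewrite /s normrM [`|2 * pi|]gtr0_norm ?mulr_gt0 //.
  apply: (@le_trans _ _ (2 * pi * 1)); first by lra.
  by rewrite ler_pM2l // mulr_gt0.
rewrite ler_pdivrMr ?mulr_gt0 // ?(lt_le_trans _ sabs) //.
rewrite [leRHS]mulrC ler_pdivlMr ?(lt_le_trans _ t2) //.
have : 4 * (3 * pi ^+ 2 * t ^+ 2) <= `|s| * (s ^+ 2 - p ^+ 2).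
  by apply: ler_pM => //; rewrite mulr_ge0 ?sqr_ge0 // mulr_ge0 ?sqr_ge0.
have : p ^+ 2 <= pi ^+ 2 by rewrite lerXn2r // nnegrE ltW.
move=> h; have : p ^+ 2 * t ^+ 2 <= pi ^+ 2 * t ^+ 2 by rewrite ler_wpM2r ?sqr_ge0.
have : 0 <= pi ^+ 2 * t ^+ 2 by rewrite mulr_ge0 ?sqr_ge0.
by lra.
Qed.

(** Apply the Schur test to the numbers [r q] of indices in cell [q]: the sum of their squares
    counts the pairs sharing a cell. *)
Lemma sum_kernel_le_diagonal (R : realFieldType) (I : finType) (p : I -> nat) :
  \sum_i \sum_j ((p i - p j + (p j - p i)).+1%:R *
                 (p i - p j + (p j - p i)).+2%:R)^-1 <=
  2 * \sum_i \sum_j (p i == p j)%:R :> R.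
Proof.
pose psi (k : nat) : R := (k.+1%:R * k.+2%:R)^-1.
pose d (k l : nat) := (k - l + (l - k))%N.
pose M := (\max_i p i).+1.
have pM i : (p i < M)%N by rewrite ltnS leq_bigmax.
pose r (q : nat) : R := \sum_i (p i == q)%:R.
have sumE (f : nat -> R) : \sum_i f (p i) = \sum_(q < M) r q * f q.
  under [RHS]eq_bigr do rewrite mulr_suml.
  by rewrite exchange_big; apply: eq_bigr => i _; rewrite (sum_eq_indic _ f).
have psi0 k : 0 <= psi k by rewrite invr_ge0 mulr_ge0.
(* The kernel telescopes, [psi k] being [1 / (k + 1) - 1 / (k + 2)], so its sums stay below 1. *)
have psi1 n : \sum_(k < n) psi k = 1 - n.+1%:R^-1.
  elim: n => [|n IH]; first by rewrite big_ord0 invr1 subrr.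
  rewrite big_ord_recr /= IH /psi -[n.+2%:R]natr1.
  have : 0 < n.+1%:R :> R by rewrite ltr0n.
  move: (n.+1%:R : R) => y y0.
  by field; rewrite !gt_eqF ?addr_gt0.
have diag : \sum_i \sum_j (p i == p j)%:R = \sum_(q < M) r q ^+ 2.
  rewrite -(sumE (fun q => r q)); apply: eq_bigr => i _.
  by apply: eq_bigr => j _; rewrite eq_sym.
have -> : \sum_i \sum_j (((p i - p j + (p j - p i)).+1%:R *
    (p i - p j + (p j - p i)).+2%:R)^-1 : R) =
    \sum_(q < M) \sum_(q' < M) psi (d q q') * (r q * r q').
  transitivity (\sum_i \sum_(q' < M) r q' * psi (d (p i) q')).
    by apply: eq_bigr => i _; exact: (sumE (fun q => psi (d (p i) q))).
  rewrite (sumE (fun q => \sum_(q' < M) r q' * psi (d q q'))).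
  apply: eq_bigr => q _; rewrite mulr_sumr; apply: eq_bigr => q' _; ring.
rewrite diag; apply: le_trans (ler_norm _) _.
apply: (schur_test _ _ (fun k l : 'I_M => psi (d k l)) (fun k => r k)) => //.
  by move=> k l; rewrite /d addnC.
move=> k; apply: le_trans (sum_dist_le _ psi _ _ psi0 (ltn_ord k)) _.
by rewrite psi1 ler_piMr // lerBlDr lerDl.
Qed.

(** Sort the frequencies into unit cells. A pair whose cells are [k] apart contributes at most
    [24 * A / ((k + 1) * (k + 2))], and two frequencies in one cell differ by less than 1. *)
Lemma sum_hann_transform_le (R : realType) (I : finType) (u : I -> R) (A : R) :
  1 <= A ->
  \sum_i \sum_j `|hann_transform R A (u i - u j)| <=
  48 * A * \sum_i \sum_j (`|u i - u j| < 1)%R%:R.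
Proof.
move=> A1; have A0 : 0 <= A by apply: le_trans A1.
(* Shifting by [S] makes all frequencies nonnegative, so that truncation acts as the floor. *)
pose S := \sum_i `|u i|.
have uS i : 0 <= u i + S.
  rewrite -lerBlDr sub0r (le_trans (_ : _ <= - `|u i|)) //.
    by rewrite lerN2 /S (bigD1 i) //= lerDl sumr_ge0.
  exact: lerNnormlW.
pose p i := Num.trunc (u i + S).
have pI i : (p i)%:R <= u i + S < (p i)%:R + 1.
  by rewrite natr1; exact: truncn_itv.
have pd i j : (p i - p j + (p j - p i))%:R - 1 < `|u i - u j|.
  have /andP[a1 a2] := pI i; have /andP[b1 b2] := pI j.
  have [ij|ij] := leqP (p i) (p j).
    rewrite (_ : (_ + _)%N = (p j - p i)%N); last lia.
    rewrite natrB // (lt_le_trans (_ : _ < - (u i - u j))) ?ler_normr ?lexx ?orbT //.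
    by lra.
  rewrite (_ : (_ + _)%N = (p i - p j)%N); last lia.
  rewrite natrB ?(ltnW ij) // (lt_le_trans (_ : _ < (u i - u j))) ?ler_norm //.
  by lra.
apply: (@le_trans _ _ (24 * A * \sum_i \sum_j
   (((p i - p j + (p j - p i)).+1%:R * (p i - p j + (p j - p i)).+2%:R)^-1))).
  rewrite mulr_sumr; apply: ler_sum => i _; rewrite mulr_sumr; apply: ler_sum => j _.
  have := pd i j; set k := (_ + _)%N; set t := u i - u j => kt.
  rewrite ler_pdivlMr ?mulr_gt0 //.
  (* Adjacent or equal cells use the trivial bound [4 * A], with [(k + 1) * (k + 2) <= 6]; beyond
     that [|t| > k - 1 >= 1] and the quadratic decay applies. *)
  have [k1|k1] := leqP k 1.
    rewrite (_ : 24 * A = (4 * A) * (2 * 3)); last by ring.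
    apply: ler_pM; rewrite ?mulr_ge0 //; first exact: hann_transform_le.
    by rewrite ler_pM // ler_nat; lia.
  have t1 : 1 <= `|t|.
    by apply/ltW/(le_lt_trans _ kt); rewrite lerBrDr -[1]/(1%:R) -natrD ler_nat.
  have h := hann_transform_decay R A t A1 t1.
  have [m km] : exists m, k = m.+2 by exists (k - 2)%N; lia.
  have kt2 : (m.+1%:R : R) ^+ 2 <= t ^+ 2.
    rewrite -[t ^+ 2]real_normK ?num_real // lerXn2r ?nnegrE //.
    by apply: le_trans (ltW kt); rewrite km -[m.+2%:R]natr1 addrK.
  have t20 : 0 < t ^+ 2 by apply: lt_le_trans kt2; rewrite exprn_gt0.
  apply: (@le_trans _ _ ((t ^+ 2)^-1 * (24 * A * t ^+ 2))); last first.
    by rewrite mulrCA mulVf ?gt_eqF // mulr1.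
  apply: ler_pM => //.
  apply: (@le_trans _ _ (24 * m.+1%:R ^+ 2)).
    by rewrite -natrX -!natrM ler_nat km; nia.
  rewrite -[leRHS]mulrA ler_pM2l //.
  by apply: le_trans kt2 _; rewrite ler_peMl // ltW.
rewrite (_ : 48 * A = 24 * A * 2); last by ring.
rewrite -[leRHS]mulrA; apply: ler_wpM2l; first by rewrite mulr_ge0.
apply: le_trans (sum_kernel_le_diagonal _ _ p) _.
apply: ler_wpM2l => //; apply: ler_sum => i _; apply: ler_sum => j _.
rewrite ler_nat; case: eqP => // pij; rewrite lt0b.
have /andP[a1 a2] := pI i; have /andP[b1 b2] := pI j; rewrite pij in a1 a2.
by rewrite ltr_norml; apply/andP; split; lra.
Qed.

(** * Weighted integrals of cosine sums and the measure of their large values *)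

Lemma is_derive_bigsum (R : realType) (I : Type) (r : seq I) (h : I -> R -> R)
    (dh : I -> R) (a : R) :
  (forall i, is_derive a 1 (h i) (dh i)) ->
  is_derive a 1 (fun x => \sum_(i <- r) h i x) (\sum_(i <- r) dh i).
Proof.
move=> hd; elim: r => [|i r IH].
  under eq_fun do rewrite big_nil.
  by rewrite big_nil; exact: is_derive_cst.
under eq_fun do rewrite big_cons.
by rewrite big_cons; exact: is_deriveD.
Qed.

Lemma continuous_bigsum (R : realType) (I : Type) (r : seq I) (h : I -> R -> R) :
  (forall i, continuous (h i)) -> continuous (fun x => \sum_(i <- r) h i x).
Proof.
move=> hc; elim: r => [|i r IH].
  by under eq_fun do rewrite big_nil; exact: cst_continuous.
under eq_fun do rewrite big_cons.
by move=> x; apply: continuousD; [exact: hc|exact: IH].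
Qed.

Lemma continuous_mul_fun (R : realType) (f g : R -> R) :
  continuous f -> continuous g -> continuous (fun x => f x * g x).
Proof. by move=> cf cg x; apply: (@continuousM _ _ f g x); [exact: cf|exact: cg]. Qed.

Lemma continuous_add_fun (R : realType) (f g : R -> R) :
  continuous f -> continuous g -> continuous (fun x => f x + g x).
Proof. by move=> cf cg x; apply: (@continuousD _ _ _ f g x); [exact: cf|exact: cg]. Qed.

Lemma continuous_cos_lin (R : realType) (l : R) : continuous (fun a => cos (l * a)).
Proof.
move=> a; apply: (@continuous_comp _ _ _ ( *%R l) cos); last exact: continuous_cos.
exact: mulrl_continuous.
Qed.

Lemma integral_derivative (R : realType) (F f : R -> R) (a b : R) : a < b ->
  continuous f -> (forall x : R, is_derive x 1 F (f x)) ->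
  (\int[lebesgue_measure]_(x in `[a, b]) (f x)%:E = (F b - F a)%R%:E)%E.
Proof.
move=> ab cf dF.
have cF : continuous F.
  by move=> x; apply/differentiable_continuous/derivable1_diffP; exact: ex_derive.
rewrite (continuous_FTC2 (F := F)) ?EFinB //.
- exact: continuous_subspaceT.
- split; [by move=> x _; exact: ex_derive| |].
    by apply: cvg_at_right_filter; exact: cF.
  by apply: cvg_at_left_filter; exact: cF.
- by move=> x _; rewrite derive1E; exact: derive_val.
Qed.

(** Product-to-sum formulas give each term an explicit primitive [g i j]. Being odd, it takes at [A]
    half the value of the integral over the symmetric interval. *)
Lemma integral_hann_weight (R : realType) (I : finType) (u b : I -> R) (A : R) : 0 < A ->
  (\int[lebesgue_measure]_(a in `[(- A)%R, A])
     ((\sum_i \sum_j b i * b j * cos (2 * pi * u i * a - 2 * pi * u j * a)) *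
      (1 + cos (pi / A * a)))%R%:E =
  (\sum_i \sum_j b i * b j * hann_transform R A (u i - u j))%R%:E)%E.
Proof.
move=> A0; pose s i j := 2 * pi * (u i - u j); pose p := pi / A.
pose g i j a := cos_primitive R (s i j) a + 2^-1 * cos_primitive R (s i j + p) a
  + 2^-1 * cos_primitive R (s i j - p) a.
pose G a := \sum_i \sum_j b i * b j * g i j a.
pose f a := \sum_i \sum_j b i * b j * (cos (s i j * a) + 2^-1 * cos ((s i j + p) * a)
  + 2^-1 * cos ((s i j - p) * a)).
have fE a : (\sum_i \sum_j b i * b j * cos (2 * pi * u i * a - 2 * pi * u j * a)) *
      (1 + cos (p * a)) = f a.
  rewrite mulr_suml; apply: eq_bigr => i _; rewrite mulr_suml.
  apply: eq_bigr => j _; rewrite -mulrA; congr (_ * _).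
  rewrite (_ : 2 * pi * u i * a - 2 * pi * u j * a = s i j * a); last by rewrite /s; ring.
  by rewrite [(s i j + p) * a]mulrDl [(s i j - p) * a]mulrBl cosD cosB; field.
under eq_integral do rewrite fE.
have cf : continuous f.
  apply: continuous_bigsum => i; apply: continuous_bigsum => j.
  apply: continuous_mul_fun; first exact: cst_continuous.
  apply: continuous_add_fun; [apply: continuous_add_fun|].
  - exact: continuous_cos_lin.
  - by apply: continuous_mul_fun; [exact: cst_continuous|exact: continuous_cos_lin].
  - by apply: continuous_mul_fun; [exact: cst_continuous|exact: continuous_cos_lin].
have dG (a : R) : is_derive a 1 G (f a).
  have h (l : R) := is_derive_cos_primitive R l a.
  by apply: is_derive_bigsum => i; exact: is_derive_bigsum.
have NA : - A < A by rewrite gtrN.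
rewrite (integral_derivative _ _ _ _ _ NA cf dG).
congr EFin; rewrite -sumrB; apply: eq_bigr => i _; rewrite -sumrB.
apply: eq_bigr => j _; rewrite -mulrBr; congr (_ * _).
by rewrite /g !cos_primitiveN /hann_transform -/p -/(s i j); field.
Qed.

(** Chebyshev's inequality for the weighted second moment. Restricting to [|a| <= A / 2] keeps the
    weight at least 1 on the set. *)
Lemma large_values_measure (R : realType) (I : finType) (u b : I -> R) (A B c : R) :
  1 <= A -> 0 < c -> (forall i, `|b i| <= B) ->
  let E := [set a | `|a| <= A / 2 /\ c <= `|\sum_i b i * cos (2 * pi * u i * a)|] in
  measurable (E : set (measurableTypeR R)) /\
  (lebesgue_measure E <=
    (48 * A * B ^+ 2 / c ^+ 2 * \sum_i \sum_j (`|u i - u j| < 1)%R%:R)%R%:E)%E.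
Proof.
move=> A1 c0 bB E; have A0 : 0 < A by apply: lt_le_trans A1.
pose S a := \sum_i b i * cos (2 * pi * u i * a).
have cS : continuous S.
  apply: continuous_bigsum => i; apply: continuous_mul_fun; first exact: cst_continuous.
  exact: continuous_cos_lin.
have mE : measurable (E : set (measurableTypeR R)).
  have -> : E = `[- (A / 2), A / 2] `&` ((fun y : R => `|y|) \o S) @^-1` `[c, +oo[.
    apply/seteqP; split => a /=.
      by move=> [h1 h2]; rewrite !in_itv /= andbT -ler_norml.
    by rewrite !in_itv /= andbT -ler_norml => -[h1 h2].
  apply: measurableI; first exact: measurable_itv.
  rewrite -[X in measurable X]setTI.
  have mS : measurable_fun setT ((fun y : R => `|y|) \o S).
    apply: continuous_measurable_fun => a.
    by apply: continuous_comp; [exact: cS|exact: norm_continuous].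
  exact: mS.
split => //.
(* Adding the square of the sine sum to [S a ^+ 2] leaves a double sum over differences of
   frequencies only, to which [integral_hann_weight] applies. *)
pose W a := (\sum_i \sum_j b i * b j * cos (2 * pi * u i * a - 2 * pi * u j * a)) *
      (1 + cos (pi / A * a)).
have WE a : W a = (S a ^+ 2 + (\sum_i b i * sin (2 * pi * u i * a)) ^+ 2) *
    (1 + cos (pi / A * a)).
  by rewrite /W (cos_sum_sqr R I b (fun i => 2 * pi * u i * a)).
have w0 a : 0 <= 1 + cos (pi / A * a) by rewrite -lerBlDl sub0r cos_geN1.
have W0 a : 0 <= W a.
  by rewrite WE mulr_ge0 // addr_ge0 ?sqr_ge0.
have cW : continuous W.
  apply: continuous_mul_fun; last first.
    by apply: continuous_add_fun; [exact: cst_continuous|exact: continuous_cos_lin].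
  apply: continuous_bigsum => i; apply: continuous_bigsum => j.
  under eq_fun do rewrite -mulrBl.
  by apply: continuous_mul_fun; [exact: cst_continuous|exact: continuous_cos_lin].
have mW (D : set R) : measurable_fun D (EFin \o W).
  apply/measurable_EFinP; apply: (@measurable_funS _ _ _ _ setT) => //.
  exact: continuous_measurable_fun.
have WC a : E a -> c ^+ 2 <= W a.
  move=> -[aA cSa]; rewrite WE.
  have h1 : 1 <= 1 + cos (pi / A * a).
    rewrite lerDl; apply: cos_ge0_pihalf; rewrite -ler_norml.
    have pi0 := @pi_gt0 R.
    rewrite normrM gtr0_norm ?divr_gt0 // (_ : pi / 2 = pi / A * (A / 2)).
      by rewrite ler_pM2l ?divr_gt0.
    by field; rewrite gt_eqF.
  rewrite -[leLHS]mulr1; apply: ler_pM => //; first exact: sqr_ge0.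
  rewrite -[leLHS]addr0 lerD ?sqr_ge0 // -[S a ^+ 2]real_normK ?num_real //.
  by rewrite lerXn2r // nnegrE // ltW.
have c20 : 0 < c ^+ 2 by rewrite exprn_gt0.
have main : ((c ^+ 2)%R%:E * lebesgue_measure (E : set (measurableTypeR R)) <=
    (\sum_i \sum_j b i * b j * hann_transform R A (u i - u j))%R%:E)%E.
  rewrite -(integral_cst lebesgue_measure mE).
  rewrite -integral_hann_weight //.
  apply: (@le_trans _ _ (\int[lebesgue_measure]_(a in E) (W a)%:E)%E).
    apply: ge0_le_integral => //; first by move=> a _; rewrite lee_fin ltW.
    exact: mW.
  apply: ge0_subset_integral => //; first exact: mW.
    by move=> a _; rewrite lee_fin.
  move=> a [aA _]; rewrite /= in_itv /= -ler_norml; apply: le_trans aA _.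
  by rewrite ler_pdivrMr // ler_pMr // ler1n.
have B0 (i : I) : 0 <= B by apply: le_trans (bB i).
have le2 : \sum_i \sum_j b i * b j * hann_transform R A (u i - u j) <=
    B ^+ 2 * (48 * A * \sum_i \sum_j (`|u i - u j| < 1)%R%:R).
  apply: le_trans (ler_wpM2l (sqr_ge0 B) (sum_hann_transform_le R I u A A1)).
  rewrite mulr_sumr; apply: ler_sum => i _; rewrite mulr_sumr; apply: ler_sum => j _.
  apply: le_trans (ler_norm _) _; rewrite normrM ler_wpM2r // normrM expr2.
  exact: ler_pM.
rewrite -(@lee_pmul2l _ (c ^+ 2)%:E) //; apply: le_trans main _.
rewrite -EFinM lee_fin; apply: le_trans le2 _.
rewrite le_eqVlt; apply/orP; left; apply/eqP; field.
by rewrite gt_eqF.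
Qed.

(** * Minimal gaps and the energy *)

Lemma cosDint (R : realType) (y : R) (k : int) : cos (y + 2 * pi * k%:~R) = cos y.
Proof.
have P n z : cos (z + 2 * pi * n%:R) = cos z :> R.
  by rewrite -[RHS](periodicn (@cosD2pi R) n) mulr2n -mulr_natr; congr cos; ring.
case: k => n; first exact: P.
rewrite NegzE mulrNz mulrN -[LHS](P n.+1); congr cos; rewrite -pmulrn; ring.
Qed.

Lemma dist_int_le (R : realType) (y : R) (k : int) : dist_int y <= `|y - k%:~R|.
Proof.
apply: ge_inf; last by exists k.
by exists 0 => _ [j _ <-].
Qed.

Lemma dist_int_ge0 (R : realType) (y : R) : 0 <= dist_int y.
Proof.
apply: lb_le_inf; first by exists `|y - 0%:~R|, 0.
by move=> _ [j _ <-].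
Qed.

Lemma dist_int_le1 (R : realType) (y : R) : dist_int y <= 1.
Proof.
apply: le_trans (dist_int_le R y (Num.floor y)) _.
have := floor_itv y; rewrite intrD => /andP[h1 h2].
by rewrite ler_norml; apply/andP; split; lra.
Qed.

(** This translates a large distance to the integers into the condition of [trig_minorant]. The
    cosine depends only on the distance to the nearest integer and decreases as that distance grows
    to one half. *)
Lemma cos_le_dist_int (R : realType) (y d : R) : 0 <= d -> d <= 2^-1 ->
  d <= dist_int y -> cos (2 * pi * y) <= cos (2 * pi * d).
Proof.
move=> d0 d2 dy; have pi0 := @pi_gt0 R.
(* [k] is an integer nearest to [y]. *)
pose k := Num.floor (y + 2^-1); pose z := `|y - k%:~R|.
have := floor_itv (y + 2^-1); rewrite -/k intrD => /andP[h1 h2].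
have z2 : z <= 2^-1 by rewrite /z ler_norml; apply/andP; split; lra.
have dz : d <= z by apply: le_trans dy _; exact: dist_int_le.
have -> : cos (2 * pi * y) = cos (2 * pi * z).
  rewrite -[RHS]cos_norm normrM normr_id -normrM cos_norm -[RHS](cosDint _ _ k).
  by congr cos; ring.
have itv (w : R) : 0 <= w -> w <= 2^-1 -> 2 * pi * w \in `[0, pi].
  move=> w0 w2; rewrite in_itv /=; apply/andP; split.
    by rewrite mulr_ge0 // mulr_ge0 // ltW.
  rewrite -mulrA mulrCA -[leRHS]mulr1 ler_pM2l //; lra.
move: dz; rewrite le_eqVlt => /predU1P[->//|dz].
have z0 : 0 <= z by exact: normr_ge0.
by apply: ltW; rewrite ltr_cos ?itv // ltr_pM2l // mulr_gt0.
Qed.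

Lemma delta_min_le (R : realType) (alpha : R) (x : nat -> R) (N m n : nat) :
  (1 <= m <= N)%N -> (1 <= n <= N)%N -> m <> n ->
  delta_min alpha x N <= dist_int (alpha * x m - alpha * x n).
Proof.
move=> mN nN mn; apply: ge_inf; last by exists m, n.
by exists 0 => _ [m' [n' [_ _ _ ->]]]; exact: dist_int_ge0.
Qed.

Lemma delta_min_le1 (R : realType) (alpha : R) (x : nat -> R) (N : nat) :
  (2 <= N)%N -> delta_min alpha x N <= 1.
Proof.
move=> N2; apply: le_trans (dist_int_le1 _ _).
by apply: (delta_min_le _ _ _ _ 1 2) => //; rewrite ?N2 ?(leq_trans _ N2).
Qed.

(** [2 <= M] guarantees a pair of distinct indices; without one the infimum at [M] would be the
    default value 0. *)
Lemma delta_min_anti (R : realType) (alpha : R) (x : nat -> R) (M N : nat) :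
  (2 <= M <= N)%N -> delta_min alpha x N <= delta_min alpha x M.
Proof.
move=> /andP[M2 MN]; apply: lb_le_inf.
  exists (dist_int (alpha * x 1%N - alpha * x 2%N)), 1%N, 2%N.
  by split=> //; rewrite ?M2 ?(leq_trans _ M2).
move=> _ [m [n [/andP[m1 mM] /andP[n1 nM] mn ->]]].
by apply: delta_min_le; rewrite ?m1 ?n1 ?(leq_trans mM) ?(leq_trans nM).
Qed.

(** Ordinals start at 0, hence the successors. A finite index type is what the second moment bound
    expects. *)
Definition pair_freq (R : realType) (x : nat -> R) (K N : nat)
  (i : 'I_K * 'I_N * 'I_N) : R := i.1.1.+1%:R * (x i.1.2.+1 - x i.2.+1).

Lemma sum_triples (R : realType) (K N : nat) (F : nat -> nat -> nat -> R) :
  \sum_(i in [pred i : 'I_K * 'I_N * 'I_N | i.1.2 != i.2]) F i.1.1.+1 i.1.2.+1 i.2.+1 =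
  \sum_(1 <= j < K.+1) \sum_(1 <= m < N.+1) \sum_(1 <= n < N.+1 | m != n) F j m n.
Proof.
rewrite big_add1 big_mkord /=.
under [RHS]eq_bigr do rewrite big_add1 big_mkord /=.
rewrite pair_big /=.
under [RHS]eq_bigr do rewrite big_add1 big_mkord /=.
rewrite pair_big_dep /=; apply: eq_bigl => -[[j m] n] /=.
by rewrite inE /= eqSS.
Qed.

(** All terms are nonnegative and every [j] up to [K] meets both cutoffs in [energy], so only
    reordering and enlarging the sums is needed. *)
Lemma sum_coincidences_le_energy (R : realType) (x : nat -> R) (e : R) (K N : nat) :
  (K <= N ^ 2)%N -> (forall j, (j <= K)%N -> j%:R < N%:R `^ e :> R) ->
  \sum_(i in [pred i : 'I_K * 'I_N * 'I_N | i.1.2 != i.2])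
  \sum_(i' in [pred i : 'I_K * 'I_N * 'I_N | i.1.2 != i.2])
    (`|pair_freq R x K N i - pair_freq R x K N i'| < 1)%R%:R
  <= energy x e N.
Proof.
move=> KN Ke.
pose F j1 m1 n1 j2 m2 n2 : R :=
  (`|j1%:R * (x m1 - x n1) - j2%:R * (x m2 - x n2)| < 1)%R%:R.
have F0 j1 m1 n1 j2 m2 n2 : 0 <= F j1 m1 n1 j2 m2 n2 by rewrite ler0n.
under eq_bigr => i _ do
  rewrite (sum_triples R K N (fun j m n => F i.1.1.+1 i.1.2.+1 i.2.+1 j m n)).
rewrite (sum_triples R K N (fun j1 m1 n1 => \sum_(1 <= j2 < K.+1)
  \sum_(1 <= m2 < N.+1) \sum_(1 <= n2 < N.+1 | m2 != n2) F j1 m1 n1 j2 m2 n2)).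
have ext (G : nat -> R) : (forall j, 0 <= G j) -> \sum_(1 <= j < K.+1) G j <=
    \sum_(1 <= j < (N ^ 2).+1 | j%:R < N%:R `^ e) G j.
  move=> G0; rewrite [leRHS](big_cat_nat (n := K.+1)) //=.
  rewrite -[leLHS]addr0 lerD ?sumr_ge0 //.
  rewrite [leRHS]big_mkcond /=; apply: ler_sum_nat => j /andP[_ jK].
  by rewrite Ke.
rewrite /energy.
have swap j1 : \sum_(1 <= m1 < N.+1) \sum_(1 <= n1 < N.+1 | m1 != n1)
    \sum_(1 <= j2 < K.+1) \sum_(1 <= m2 < N.+1) \sum_(1 <= n2 < N.+1 | m2 != n2)
      F j1 m1 n1 j2 m2 n2 =
  \sum_(1 <= j2 < K.+1) \sum_(1 <= m1 < N.+1) \sum_(1 <= n1 < N.+1 | m1 != n1)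
    \sum_(1 <= m2 < N.+1) \sum_(1 <= n2 < N.+1 | m2 != n2) F j1 m1 n1 j2 m2 n2.
  by rewrite [RHS]exchange_big; apply: eq_bigr => m1 _; rewrite [RHS]exchange_big.
under eq_bigr do rewrite swap.
have pos j1 j2 : 0 <= \sum_(1 <= m1 < N.+1) \sum_(1 <= n1 < N.+1 | m1 != n1)
    \sum_(1 <= m2 < N.+1) \sum_(1 <= n2 < N.+1 | m2 != n2) F j1 m1 n1 j2 m2 n2.
  by do 4!(apply: sumr_ge0 => ? _).
apply: le_trans (ext _ _) _; first by move=> j; apply: sumr_ge0.
by apply: ler_sum => j1 _; exact: ext.
Qed.

(** Every pair [m != n] satisfies the condition of the minorant. Summing over the [N * (N - 1)]
    pairs, the constant terms 1 must be cancelled by the oscillating part. *)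
Lemma large_gap_large_sum (R : realType) (alpha : R) (x : nat -> R) (K N : nat)
    (b : nat -> R) : (0 < K)%N ->
  (forall t : R, cos t <= cos (2 * (pi / K.+1%:R)) ->
      1 + \sum_(1 <= j < K.+1) b j * cos (j%:R * t) <= 0) ->
  (2 <= N)%N -> K.+1%:R^-1 <= delta_min alpha x N ->
  N%:R ^+ 2 / 2 <= `|\sum_(i in [pred i : 'I_K * 'I_N * 'I_N | i.1.2 != i.2])
     b i.1.1.+1 * cos (2 * pi * pair_freq R x K N i * alpha)|.
Proof.
move=> K0 hb N2 hd.
pose F j m n := b j * cos (2 * pi * (j%:R * (x m - x n)) * alpha).
rewrite (sum_triples R K N F).
have -> : \sum_(1 <= j < K.+1) \sum_(1 <= m < N.+1) \sum_(1 <= n < N.+1 | m != n) F j m n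
   = \sum_(1 <= m < N.+1) \sum_(1 <= n < N.+1 | m != n) \sum_(1 <= j < K.+1) F j m n.
  by rewrite exchange_big; apply: eq_bigr => m _; rewrite exchange_big.
set T := \sum_(1 <= m < N.+1) _.
have le0 : \sum_(1 <= m < N.+1) \sum_(1 <= n < N.+1 | m != n)
    (1 + \sum_(1 <= j < K.+1) F j m n) <= 0.
  rewrite big_nat_cond; apply: sumr_le0 => m; rewrite andbT ltnS => mN.
  rewrite big_nat_cond; apply: sumr_le0 => n /andP[]; rewrite ltnS => nN /eqP mn.
  have := hb (2 * pi * (alpha * x m - alpha * x n)).
  have -> : 2 * (pi / K.+1%:R) = 2 * pi * K.+1%:R^-1 :> R by rewrite mulrA.
  have -> : \sum_(1 <= j < K.+1) b j * cos (j%:R * (2 * pi * (alpha * x m - alpha * x n)))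
     = \sum_(1 <= j < K.+1) F j m n.
    by apply: eq_bigr => j _; rewrite /F; congr (_ * cos _); ring.
  apply; apply: cos_le_dist_int => //.
    by rewrite lef_pV2 ?posrE // ler_nat.
  by apply: le_trans hd _; exact: delta_min_le.
have cnt : \sum_(1 <= m < N.+1) \sum_(1 <= n < N.+1 | m != n) (1 : R) =
    N%:R * (N%:R - 1).
  transitivity (\sum_(1 <= m < N.+1) (N%:R - 1 : R)); last first.
    by rewrite big_const_nat subn1 /= iter_addr_0 -[LHS]mulr_natl.
  apply: eq_big_nat => m mN.
  have : \sum_(1 <= n < N.+1) (1 : R) = N%:R.
    by rewrite big_const_nat subn1 /= iter_addr_0.
  rewrite (bigD1_seq m) ?mem_index_iota ?iota_uniq //= => <-.
  by rewrite addrAC subrr add0r; apply: eq_bigl => n; rewrite eq_sym.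
have : N%:R * (N%:R - 1) + T <= 0.
  rewrite -cnt -big_split /=; apply: le_trans le0.
  by apply: ler_sum => m _; rewrite -big_split.
have : 2 <= N%:R :> R by rewrite ler_nat.
move=> n2 h; apply: le_trans (_ : _ <= - T) _; last by rewrite -normrN ler_norm.
(* For [N >= 2], [N * (N - 1)] is at least [N ^ 2 / 2]. *)
nra.
Qed.

(** * Exceptional sets and the passage to almost every [alpha] *)

Lemma powR_gt1 (R : realType) (a r : R) : 1 < a -> 0 < r -> 1 < a `^ r.
Proof.
move=> a1 r0; have <- : 1 `^ r = 1 :> R by rewrite powR1.
by rewrite gt0_ltr_powR // nnegrE; lra.
Qed.

(** The strict bound [K < y] matches the cutoff in [energy]; [y <= K + 1] turns a gap of at least
    [1 / y] into one of at least [1 / (K + 1)]. *)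
Lemma nat_below (R : realType) (y : R) : 1 < y ->
  exists K : nat, [/\ (0 < K)%N, K%:R < y & y <= K.+1%:R].
Proof.
move=> y1; have y0 : 0 <= y by lra.
have ex : exists n : nat, y <= n%:R.
  by exists (Num.trunc y).+1; have /andP[_ /ltW] := truncn_itv y0.
case: (ex_minnP ex) => [[|[|n]] yn mn]; [lra|lra|].
exists n.+1; split => //; rewrite ltNge; apply/negP => /mn.
by rewrite ltnn.
Qed.

Lemma large_gap_measure (R : realType) (x : nat -> R) (e A : R) (N : nat) :
  1 <= A -> 0 < e -> e <= 2 -> (2 <= N)%N ->
  exists B : set (measurableTypeR R), [/\ measurable B,
    forall alpha : R, `|alpha| <= A / 2 -> (N%:R `^ e)^-1 <= delta_min alpha x N ->
      B alpha &
    (lebesgue_measure B <= (48 * 144 * A * (energy x e N / N%:R ^+ 4))%R%:E)%E].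
Proof.
move=> A1 e0 e2 N2.
have N1 : 1 < N%:R :> R by rewrite ltr1n.
have N0 : 0 < N%:R :> R by lra.
have Ne1 : 1 < N%:R `^ e by exact: powR_gt1.
have [K [K0 KNe NeK]] := nat_below _ _ Ne1.
have KN : (K <= N ^ 2)%N.
  rewrite -(ler_nat R) natrX; apply/ltW/(lt_le_trans KNe).
  by rewrite -powR_mulrn ?ler_powR // ltW.
have Kj j : (j <= K)%N -> j%:R < N%:R `^ e :> R.
  by move=> jK; apply: le_lt_trans KNe; rewrite ler_nat.
have [b [b6 hb]] := trig_minorant R K K0.
pose D := [pred i : 'I_K * 'I_N * 'I_N | i.1.2 != i.2].
(* The second moment bound sums over a whole finite type, so the triples with [m != n] are
   enumerated. *)
pose u (k : 'I_#|D|) := pair_freq R x K N (enum_val k).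
pose v (k : 'I_#|D|) := b (enum_val k).1.1.+1.
pose c : R := N%:R ^+ 2 / 2.
have c0 : 0 < c by rewrite divr_gt0 // exprn_gt0.
have [] := large_values_measure R _ u v A 6 c A1 c0 (fun k => b6 _).
set B := [set _ | _] => mB muB; exists B; split => //.
  move=> alpha aA hd; split => //.
  rewrite -(big_enum_val (A := D)
    (fun i => b i.1.1.+1 * cos (2 * pi * pair_freq R x K N i * alpha))).
  apply: (large_gap_large_sum R alpha x K N b K0 hb N2).
  by apply: le_trans hd; rewrite lef_pV2 ?posrE // (lt_trans _ Ne1).
apply: le_trans muB _; rewrite lee_fin.
(* The constant 144 is [6 ^ 2 * 4]: coefficients are at most 6, and the threshold [N ^ 2 / 2] is
   squared. *)
rewrite (_ : 48 * A * 6 ^+ 2 / c ^+ 2 = 48 * 144 * A / N%:R ^+ 4); last first.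
  by rewrite /c; field; rewrite gt_eqF.
rewrite [energy _ _ _ / _]mulrC mulrA; apply: ler_wpM2l.
  apply: divr_ge0; last by apply: exprn_ge0; exact: ltW.
  apply: mulr_ge0; first by apply: mulr_ge0; exact: ler0n.
  exact: le_trans A1.
apply: le_trans (sum_coincidences_le_energy R x e K N KN Kj).
rewrite (big_enum_val (A := D)) /=.
by under [leRHS]eq_bigr do rewrite (big_enum_val (A := D)).
Qed.

(** The measures sum to at most [C / (1 - z)], so the limit superior of the sets is null. *)
Lemma borel_cantelli_geometric (R : realType) (B : nat -> set (measurableTypeR R))
    (C z : R) : 0 <= C -> 0 <= z < 1 -> (forall k, measurable (B k)) ->
  (forall k, (lebesgue_measure (B k) <= (C * z ^+ k)%R%:E)%E) ->
  {ae (@lebesgue_measure R), forall a, exists k0, forall k, (k0 <= k)%N -> ~ B k a}.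
Proof.
move=> C0 /andP[z0 z1] mB hB.
exists (lim_sup_set B); split.
- by apply: bigcapT_measurable => n; apply: bigcup_measurable => k _.
- apply: lim_sup_set_cvg0 => //.
  apply: (@le_lt_trans _ _ (C / (1 - z))%:E); last exact: ltry.
  apply: lime_le; first exact: is_cvg_nneseries.
  apply: nearW => n.
  apply: (@le_trans _ _ (\sum_(0 <= k < n) (C * z ^+ k)%:E)%E).
    by apply: lee_sum => k _; exact: hB.
  rewrite sumEFin lee_fin -mulr_sumr; apply: ler_wpM2l => //.
  have s1 : (1 - z) * \sum_(0 <= k < n) z ^+ k = 1 - z ^+ n.
    by rewrite big_mkord -opprB mulNr -subrX1 opprB.
  have zn : 0 <= z ^+ n by rewrite exprn_ge0.
  by rewrite -[leRHS]mul1r ler_pdivlMr ?subr_gt0 // mulrC s1; lra.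
- move=> a /= na n _; apply: contrapT => nB; apply: na; exists n => k nk Bk.
  by apply: nB; exists k.
Qed.

(** Compare [N] with the largest power of two below or equal to it: by monotonicity this costs a
    factor of at most [2 ^ e]. *)
Lemma delta_min_le_of_dyadic (R : realType) (alpha : R) (x : nat -> R) (e : R) (k0 : nat) :
  0 <= e ->
  (forall k, (k0 <= k)%N ->
    delta_min alpha x (2 ^ k.+1) <= ((2 ^ k.+1)%N%:R `^ e)^-1) ->
  exists K : R, forall N : nat, (2 <= N)%N -> delta_min alpha x N <= K / N%:R `^ e.
Proof.
move=> e0 hk; pose m := (2 ^ k0.+1)%N.
exists (m%:R `^ e + 2 `^ e) => N N2.
have N0 : 0 < N%:R :> R by rewrite ltr0n (leq_trans _ N2).
have Ne0 : 0 < N%:R `^ e by exact: powR_gt0.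
have mono (a b : nat) : (a <= b)%N -> a%:R `^ e <= b%:R `^ e :> R.
  by move=> ab; rewrite ge0_ler_powR ?nnegrE // ler_nat.
have m0 : 0 <= m%:R `^ e :> R by exact: powR_ge0.
have t0 : 0 <= 2 `^ e :> R by exact: powR_ge0.
rewrite ler_pdivlMr //.
have /andP[l1 l2] := trunc_log_bounds (isT : (1 < 2)%N) (ltnW N2).
move: l1 l2; case: (trunc_log 2 N) => [|k] l1 l2; first by lia.
have [kk|kk] := leqP k0 k.
  have M2 : (2 <= 2 ^ k.+1)%N by rewrite expnS leq_pmulr // expn_gt0.
  set M := (2 ^ k.+1)%N in l1 l2 M2.
  have M0 : 0 < M%:R `^ e :> R by rewrite powR_gt0 // ltr0n (leq_trans _ M2).
  have h : delta_min alpha x N <= (M%:R `^ e)^-1.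
    apply: le_trans (hk _ kk); apply: delta_min_anti; by rewrite M2.
  have NM : N%:R `^ e <= 2 `^ e * M%:R `^ e :> R.
    by rewrite -powRM // -natrM; apply: mono; rewrite ltnW // -expnS.
  apply: (@le_trans _ _ ((M%:R `^ e)^-1 * N%:R `^ e)); first by rewrite ler_pM2r.
  rewrite mulrC ler_pdivrMr //; apply: le_trans NM _.
  by rewrite ler_pM2r // lerDr.
(* Here [k < k0] forces [N < m], and the trivial bound 1 suffices; this is the first summand of the
   constant. *)
apply: (@le_trans _ _ (1 * N%:R `^ e)).
  by rewrite ler_pM2r //; exact: delta_min_le1.
rewrite mul1r -[leLHS]addr0 lerD //; apply: mono.
by apply/ltnW/(leq_trans l2); rewrite leq_exp2l.
Qed.

Lemma energy_ge0 (R : realType) (x : nat -> R) (e : R) (N : nat) : 0 <= energy x e N.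
Proof. by rewrite /energy; do 6!(apply: sumr_ge0 => ? _). Qed.

Lemma delta_min_ae (R : realType) (x : nat -> R) (beta eps C A : R) :
  1 <= A -> 0 < eps -> eps < beta -> beta <= 2 ->
  (forall N : nat, energy x (beta - eps) N <= C * N%:R `^ (4 - eps)) ->
  {ae (@lebesgue_measure R), forall alpha : R, `|alpha| <= A / 2 ->
     exists K : R, forall N : nat, (2 <= N)%N ->
       delta_min alpha x N <= K / N%:R `^ (beta - eps)}.
Proof.
move=> A1 eps0 epsb beta2 hE; set e := beta - eps.
have e0 : 0 < e by rewrite subr_gt0.
have e2 : e <= 2 by rewrite /e; lra.
have A0 : 0 <= A by lra.
pose N k := (2 ^ k.+1)%N.
have N2 k : (2 <= N k)%N by rewrite /N expnS leq_pmulr // expn_gt0.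
have [B hB] := choice (fun k => large_gap_measure R x e A (N k) A1 e0 e2 (N2 k)).
pose z : R := 2 `^ (- eps).
have z0 : 0 < z by exact: powR_gt0.
have z1 : z < 1 by rewrite /z powRN invf_lt1 ?powR_gt0 // powR_gt1 // ltr1n.
(* At [N = 1] the power of [N] is 1, so [C] dominates a nonnegative energy. *)
have C0 : 0 <= C.
  have := hE 1%N; rewrite powR1 mulr1; apply: le_trans; exact: energy_ge0.
(* Dividing the energy bound by [N ^ 4] leaves [C * N ^ (- eps)], which at [N = 2 ^ (k + 1)] is
   [C * z ^ (k + 1)]. *)
have muB k : (lebesgue_measure (B k) <= (48 * 144 * A * C * z * z ^+ k)%R%:E)%E.
  have [_ _ h] := hB k; apply: le_trans h _; rewrite lee_fin.
  rewrite -[_ * C * z * _]mulrA -[_ * C * _]mulrA; apply: ler_wpM2l.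
    by apply: mulr_ge0 => //; apply: mulr_ge0; exact: ler0n.
  have N0 : 0 < (N k)%:R :> R by rewrite ltr0n (leq_trans _ (N2 k)).
  rewrite ler_pdivrMr ?exprn_gt0 //; apply: le_trans (hE (N k)) _.
  rewrite -!mulrA; apply: ler_wpM2l => //.
  rewrite powRB; last by rewrite (gt_eqF N0) implybT.
  rewrite (powR_mulrn 4 (ltW N0)) mulrA -exprS mulrC ler_wpM2r ?exprn_ge0 ?(ltW N0) //.
  by rewrite /z -powR_mulrn ?powR_ge0 // -powRrM mulrC powRrM powR_mulrn // -natrX powRN.
have C1 : 0 <= 48 * 144 * A * C * z.
  apply: mulr_ge0; last exact: ltW.
  by apply: mulr_ge0 => //; apply: mulr_ge0 => //; apply: mulr_ge0; exact: ler0n.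
have z01 : 0 <= z < 1 by rewrite ltW.
have mB k : measurable (B k) by have [] := hB k.
apply: filterS (borel_cantelli_geometric R B _ z C1 z01 mB muB).
move=> alpha [k0 hk] aA; apply: (delta_min_le_of_dyadic R alpha x e k0 (ltW e0)).
move=> k kk; rewrite leNgt; apply/negP => /ltW h.
by have [_ hsub _] := hB k; apply: (hk k kk); exact: hsub.
Qed.

Theorem theorem2 (R : realType) (beta : R) (x : nat -> R) (c : R) :
  1 < beta -> beta <= 2 ->
  0 < c ->
  (forall n : nat, (1 <= n)%N -> c <= x n.+1 - x n) ->
  (forall eps : R, 0 < eps -> exists C : R, forall N : nat,
      energy x (beta - eps) N <= C * N%:R `^ (4 - eps)) ->
  {ae (@lebesgue_measure R), forall alpha : R,
     forall eps : R, 0 < eps -> exists K : R, forall N : nat, (2 <= N)%N ->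
       delta_min alpha x N <= K / N%:R `^ (beta - eps)}.
Proof.
move=> beta1 beta2 _ _ hE.
(* Null sets may be united only countably often: [alpha] is confined to intervals indexed by [q],
   and the exponent loss to the values [1 / (p + 1)]. *)
have hae : {ae (@lebesgue_measure R), forall alpha : R, forall q p : nat,
    `|alpha| <= q.+1%:R / 2 -> exists K : R, forall N : nat, (2 <= N)%N ->
       delta_min alpha x N <= K / N%:R `^ (beta - p.+1%:R^-1)}.
  apply: ae_foralln => q; apply: ae_foralln => p.
  have p0 : 0 < p.+1%:R^-1 :> R by rewrite invr_gt0.
  (* Here [beta > 1] keeps the exponent positive for every [p], including [p = 0]. *)
  have p1 : p.+1%:R^-1 < beta.
    by apply: le_lt_trans beta1; rewrite invf_le1 // ler1n.
  have [C hC] := hE _ p0.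
  by apply: delta_min_ae hC => //; rewrite ler1n.
apply: negligibleS hae => alpha; apply: contra_not => h eps eps0.
pose q := Num.trunc (2 * `|alpha|); pose p := Num.trunc eps^-1.
have aq : `|alpha| <= q.+1%:R / 2.
  have /andP[_ /ltW] : q%:R <= 2 * `|alpha| < q.+1%:R by apply: truncn_itv; rewrite mulr_ge0.
  by lra.
have pe : p.+1%:R^-1 <= eps.
  have /andP[_ /ltW] : p%:R <= eps^-1 < p.+1%:R by apply: truncn_itv; rewrite invr_ge0 ltW.
  by rewrite -[leRHS]invrK lef_pV2 ?posrE ?invr_gt0.
(* The absolute value makes the constant nonnegative, so that lowering the exponent from
   [beta - 1 / (p + 1)] to [beta - eps] only weakens the bound. *)
have [K hK] := h q p aq; exists `|K| => N N2.
have N1 : 1 <= N%:R :> R by rewrite ler1n (leq_trans _ N2).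
have N0 : 0 < N%:R :> R by lra.
apply: le_trans (hK N N2) _; apply: (@le_trans _ _ (`|K| / N%:R `^ (beta - p.+1%:R^-1))).
  by rewrite ler_wpM2r ?invr_ge0 ?powR_ge0 // ler_norm.
by rewrite ler_wpM2l // lef_pV2 ?posrE ?powR_gt0 // ler_powR // lerB.
Qed.
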